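(* Let $G=(N,M_0,\mathcal{M}_F)$ be a bounded deadlock-free plant, let $\pi=(T_E,T_I)$ be a basis partition of the transition set of $N$, and let $\mathcal{B}_M$ be the minimax basis reachability graph (minimax-BRG) of $\langle N,M_0\rangle$ with respect to $\pi$. Then $G$ is nonblocking if and only if $\mathcal{B}_M$ is unobstructed.
   Context: **Petri nets.** A Petri net is $N=(P,T,Pre,Post)$ with a finite set $P$ of $m$ places, a finite set $T$ of transitions, and functions $Pre,Post:P\times T\to\mathbb{N}$ ($\mathbb{N}=\{0,1,2,\dots\}$); $C=Post-Pre$, and $A(\cdot,t)$ is the column of a matrix $A$ at $t$. A marking is a vector $M\in\mathbb{N}^m$. Transition $t$ is enabled at $M$ if $M\ge Pre(\cdot,t)$ componentwise, and its firing yields $M'=M+C(\cdot,t)$, written $M[t\rangle M'$. This extends to finite sequences $\sigma\in T^*$ (with $M[\varepsilon\rangle M$ for the empty sequence): $M[\sigma\rangle M'$; $M[\sigma\rangle$ means $\sigma$ can be fired at $M$. $R(N,M)$ is the set of markings reachable from $M$. A marked net is a pair $\langle N,M_0\rangle$ with initial marking $M_0$; it is bounded if there is $k\in\mathbb{N}$ with $M(p)\le k$ for all $M\in R(N,M_0)$, $p\in P$. A marking is dead if no transition is enabled at it; a marked net is deadlock-free if no marking in $R(N,M_0)$ is dead. **Plants.** A plant $G=(N,M_0,\mathcal{M}_F)$ is a marked net together with a set $\mathcal{M}_F$ of final markings, which is either a finite subset of $R(N,M_0)$ or a set of the form $\{M\in\mathbb{N}^m\mid \mathbf{w}^T M\le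 k\}$ with $\mathbf{w}\in\mathbb{Z}^m$, $k\in\mathbb{Z}$. It is bounded (deadlock-free) if $\langle N,M_0\rangle$ is. A marking $M\in R(N,M_0)$ is nonblocking if $R(N,M)\cap\mathcal{M}_F\ne\emptyset$, and blocking otherwise; $G$ is nonblocking if all markings in $R(N,M_0)$ are nonblocking. **Basis partitions.** A basis partition is a pair $\pi=(T_E,T_I)$ with $T=T_E\cup T_I$ disjoint (explicit and implicit transitions) such that the $T_I$-induced sub-net (same places, only the transitions in $T_I$, with $Pre,Post$ restricted) has no directed cycle in its underlying digraph (arcs $p\to t$ when $Pre(p,t)>0$, $t\to p$ when $Post(p,t)>0$). Let $n_I=|T_I|$ and let $C_I$ be the incidence matrix of this sub-net. For $\sigma\in T_I^*$, $\varphi(\sigma)\in\mathbb{N}^{n_I}$ is the vector counting occurrences of each transition in $\sigma$. **Explanations.** For a marking $M$ and $t\in T_E$: $\Sigma(M,t)=\{\sigma\in T_I^*\mid M[\sigma\rangle M',\ M'\ge Pre(\cdot,t)\}$; $\Sigma_{\min}(M,t)$ (resp. $\Sigma_{\max}(M,t)$) is the set of $\sigma\in\Sigma(M,t)$ for which there is no $\sigma'\in\Sigma(M,t)$ with $\varphi(\sigma')\le\varphi(\sigma)$ (resp. $\ge$) componentwise and $\varphi(\sigma')\neq\varphi(\sigma)$; $Y_{\min}(M,t)=\varphi(\Sigma_{\min}(M,t))$, $Y_{\max}(M,t)=\varphi(\Sigma_{\max}(M,t))$. **Minimax basis markings and minimax-BRG.** The set $\mathcal{M}_{B_M}$ of minimax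 basis markings is the smallest set such that $M_0\in\mathcal{M}_{B_M}$, and whenever $M\in\mathcal{M}_{B_M}$, $t\in T_E$ and $\mathbf{y}\in Y_{\min}(M,t)\cup Y_{\max}(M,t)$, then $M+C_I\mathbf{y}+C(\cdot,t)\in\mathcal{M}_{B_M}$. For a bounded marked net, the minimax-BRG is the finite automaton $\mathcal{B}_M$ with state set $\mathcal{M}_{B_M}$, initial state $M_0$, events the pairs $(t,\mathbf{y})\in T_E\times\mathbb{N}^{n_I}$ labelling its transitions, and transition relation $\Delta_M=\{(M_1,(t,\mathbf{y}),M_2)\mid t\in T_E,\ \mathbf{y}\in Y_{\min}(M_1,t)\cup Y_{\max}(M_1,t),\ M_2=M_1+C_I\mathbf{y}+C(\cdot,t)\}$, extended to finite (possibly empty) sequences of events. **Unobstructedness.** For $M_b\in\mathcal{M}_{B_M}$ the implicit reach is $R_I(M_b)=\{M\in\mathbb{N}^m\mid \exists\sigma\in T_I^*:\ M_b[\sigma\rangle M\}$. Let $\mathcal{M}_{i_{co}}=\{M_b\in\mathcal{M}_{B_M}\mid R_I(M_b)\cap\mathcal{M}_F\ne\emptyset\}$. $\mathcal{B}_M$ is unobstructed if for every $M_b\in\mathcal{M}_{B_M}$ there exist $M_b'\in\mathcal{M}_{i_{co}}$ and a finite sequence $\sigma^+$ of events with $(M_b,\sigma^+,M_b')\in\Delta_M$.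
   Formalization: The formal theorem additionally assumes that every implicit transition has at least one input or output place; an isolated implicit transition could fire forever, making deadlock-freeness vacuous and all maximal explanation sets empty, and the claim then fails. *)

(* Defs.v *)
From HB Require Import structures.
From mathcomp Require Import all_boot all_order all_algebra.
From mathcomp Require Import boolp classical_sets cardinality.

Set Implicit Arguments.
Unset Strict Implicit.
Unset Printing Implicit Defensive.

Import Order.TTheory GRing.Theory Num.Theory.

Local Open Scope classical_set_scope.
Local Open Scope ring_scope.

Record net := Net {
  place : finType;
  trans : finType;
  Pre : place -> trans -> nat;
  Post : place -> trans -> nat
}.
Arguments Pre : clear implicits.
Arguments Post : clear implicits.

Definition incidence (N : net) (p : place N) (t : trans N) : int :=
  (Post N p t)%:Z - (Pre N p t)%:Z.

Definition marking (N : net) := {ffun place N -> nat}.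

Definition enabled (N : net) (M : marking N) (t : trans N) : bool :=
  [forall p, (Pre N p t <= M p)%N].

Definition fire1 (N : net) (M : marking N) (t : trans N) (M' : marking N) :
    Prop :=
  enabled M t /\ forall p, (M' p)%:Z = (M p)%:Z + incidence p t.

Fixpoint fire (N : net) (M : marking N) (s : seq (trans N))
    (M' : marking N) : Prop :=
  if s is t :: s' then exists M1, fire1 M t M1 /\ fire M1 s' M' else M' = M.

Definition reach (N : net) (M : marking N) : set (marking N) :=
  [set M' | exists s, fire M s M'].

Definition dead (N : net) (M : marking N) : Prop :=
  forall t, ~~ enabled M t.

Record plant := Plant {
  pnet : net;
  M0 : marking pnet;
  final : set (marking pnet);
  final_spec :
    (finite_set final /\ final `<=` reach M0) \/
    exists (w : place pnet -> int) (k : int),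
      final = [set M | \sum_p w p * (M p)%:Z <= k]
}.
Arguments M0 : clear implicits.
Arguments final : clear implicits.

Definition bounded (G : plant) : Prop :=
  exists k : nat, forall M, reach (M0 G) M -> forall p, (M p <= k)%N.

Definition deadlock_free (G : plant) : Prop :=
  forall M, reach (M0 G) M -> ~ dead M.

Definition nonblocking_marking (G : plant) (M : marking (pnet G)) : Prop :=
  reach M `&` final G !=set0.

Definition nonblocking (G : plant) : Prop :=
  forall M, reach (M0 G) M -> nonblocking_marking M.

Definition subnet (N : net) (A : {set trans N}) : net :=
  @Net (place N) {t : trans N | t \in A}
    (fun p t => Pre N p (val t)) (fun p t => Post N p (val t)).

Definition net_arc (N : net) (x y : place N + trans N) : bool :=
  match x, y with
  | inl p, inr t => (0 < Pre N p t)%N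
  | inr t, inl p => (0 < Post N p t)%N
  | _, _ => false
  end.

Definition acyclic (N : net) : Prop :=
  forall c : seq (place N + trans N), path.cycle (@net_arc N) c -> c = [::].

Record basis_partition (N : net) := BasisPartition {
  explicit : {set trans N};
  implicit : {set trans N};
  partition_cover : explicit :|: implicit = [set: trans N]%SET;
  partition_disjoint : explicit :&: implicit = finset.set0;
  partition_acyclic : acyclic (subnet implicit)
}.

Definition explicit_trans (N : net) (pi : basis_partition N) : finType :=
  {t : trans N | t \in explicit pi}.

Definition inet (N : net) (pi : basis_partition N) : net :=
  subnet (implicit pi).

Definition implicit_trans (N : net) (pi : basis_partition N) : finType :=
  trans (inet pi).

Definition ivector (N : net) (pi : basis_partition N) :=
  {ffun implicit_trans pi -> nat}.

Definition parikh (N : net) (pi : basis_partition N) (s : seq (implicit_trans pi)) :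
    ivector pi :=
  [ffun t => count_mem t s].

Definition vle (N : net) (pi : basis_partition N) (y z : ivector pi) : bool :=
  [forall t, (y t <= z t)%N].

Definition ifire (N : net) (pi : basis_partition N) (M : marking N)
    (s : seq (implicit_trans pi)) (M' : marking N) : Prop :=
  fire M [seq val t | t <- s] M'.

Definition Sigma (N : net) (pi : basis_partition N) (M : marking N)
    (t : explicit_trans pi) : set (seq (implicit_trans pi)) :=
  [set s | exists M', ifire M s M' /\ enabled M' (val t)].

Definition Sigma_min (N : net) (pi : basis_partition N) (M : marking N)
    (t : explicit_trans pi) : set (seq (implicit_trans pi)) :=
  [set s | Sigma M t s /\
    ~ exists s', [/\ Sigma M t s', vle (parikh s') (parikh s)
                   & parikh s' <> parikh s]].

Definition Sigma_max (N : net) (pi : basis_partition N) (M : marking N)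
    (t : explicit_trans pi) : set (seq (implicit_trans pi)) :=
  [set s | Sigma M t s /\
    ~ exists s', [/\ Sigma M t s', vle (parikh s) (parikh s')
                   & parikh s' <> parikh s]].

Definition Y_min (N : net) (pi : basis_partition N) (M : marking N)
    (t : explicit_trans pi) : set (ivector pi) :=
  @parikh N pi @` Sigma_min M t.

Definition Y_max (N : net) (pi : basis_partition N) (M : marking N)
    (t : explicit_trans pi) : set (ivector pi) :=
  @parikh N pi @` Sigma_max M t.

Definition event (N : net) (pi : basis_partition N) : Type :=
  (explicit_trans pi * ivector pi)%type.

Definition minimax_step (N : net) (pi : basis_partition N) (M1 : marking N)
    (e : event pi) (M2 : marking N) : Prop :=
  (Y_min M1 e.1 `|` Y_max M1 e.1) e.2 /\
  forall p : place N,
    (M2 p)%:Z = (M1 p)%:Z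
      + \sum_(t : implicit_trans pi) @incidence (inet pi) p t * (e.2 t)%:Z
      + incidence p (val e.1).

Inductive minimax_basis (N : net) (pi : basis_partition N)
    (Minit : marking N) : marking N -> Prop :=
| minimax_basis_init : minimax_basis pi Minit Minit
| minimax_basis_step M1 (e : event pi) M2 :
    minimax_basis pi Minit M1 -> minimax_step M1 e M2 ->
    minimax_basis pi Minit M2.

Record automaton (Q E : Type) := Automaton {
  states : set Q;
  initial : Q;
  delta : Q -> E -> Q -> Prop
}.

Fixpoint run (Q E : Type) (A : automaton Q E) (q : Q) (s : seq E) (q' : Q) :
    Prop :=
  if s is e :: s' then exists q1, delta A q e q1 /\ run A q1 s' q' else q' = q.

Definition minimax_BRG (N : net) (Minit : marking N)
    (pi : basis_partition N) : automaton (marking N) (event pi) :=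
  {| states := minimax_basis pi Minit;
     initial := Minit;
     delta := fun M1 e M2 => minimax_basis pi Minit M1 /\ minimax_step M1 e M2 |}.

Definition implicit_reach (N : net) (pi : basis_partition N)
    (Mb : marking N) : set (marking N) :=
  [set M | exists s : seq (implicit_trans pi), ifire Mb s M].

Definition coreach_basis (G : plant) (pi : basis_partition (pnet G)) :
    set (marking (pnet G)) :=
  [set Mb | states (minimax_BRG (M0 G) pi) Mb /\
            implicit_reach pi Mb `&` final G !=set0].

Definition unobstructed (G : plant) (pi : basis_partition (pnet G)) : Prop :=
  forall Mb, states (minimax_BRG (M0 G) pi) Mb ->
  exists Mb' s, coreach_basis pi Mb' /\ run (minimax_BRG (M0 G) pi) Mb s Mb'.

(* Without this condition an implicit transition with neither input nor output
   places could fire forever without changing the marking: it is acyclic and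
   keeps the net bounded and deadlock-free, but makes every Y_max empty. *)
Definition no_isolated_implicit (N : net) (pi : basis_partition N) : Prop :=
  forall t, t \in implicit pi ->
  exists p, (0 < Pre N p t)%N || (0 < Post N p t)%N.

(* Main.v *)
(* In an acyclic net the state equation characterises reachability, so implicit
   firings can be postponed or completed as soon as the counts allow it. With
   minimal explanations, every firing sequence from a basis marking is shadowed
   by a run of the minimax-BRG up to an implicit reach. With maximal ones, every
   reachable marking reaches a basis marking. Maximal explanations exist because
   boundedness forbids implicit source transitions, so that a weight on places
   strictly decreases at each implicit firing. *)
Require Import Defs.
From mathcomp Require Import all_boot all_order all_algebra.
From mathcomp Require Import boolp classical_sets cardinality.
From mathcomp Require Import zify ring.

Set Implicit Arguments.
Unset Strict Implicit.
Unset Printing Implicit Defensive.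

Import Order.TTheory GRing.Theory Num.Theory.

Local Open Scope classical_set_scope.
Local Open Scope ring_scope.

(** * Firing sequences and the state equation *)

Section NetTheory.
Variable N : net.
Implicit Types (M : marking N) (t : trans N) (s : seq (trans N)).

Definition effect (p : place N) (y : trans N -> nat) : int :=
  \sum_t incidence p t * (y t)%:Z.

Lemma enabled_fire1 M t : enabled M t -> exists M', fire1 M t M'.
Proof.
move=> en; exists [ffun p => (M p - Pre N p t + Post N p t)%N]; split=> // p.
by move/forallP: en => /(_ p); rewrite ffunE /incidence; lia.
Qed.

Lemma fire_cat M s1 s2 M' M'' :
  fire M s1 M' -> fire M' s2 M'' -> fire M (s1 ++ s2) M''.
Proof.
elim: s1 M => [|t s1 IHs] M /=; first by move->.
by move=> [M1 [MtM1 M1s1]] /(IHs _ M1s1) ?; exists M1.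
Qed.

Lemma fire_rcons M s M' t M'' :
  fire M s M' -> fire1 M' t M'' -> fire M (rcons s t) M''.
Proof.
by move=> Ms M't; rewrite -cats1; apply: fire_cat Ms _; exists M''.
Qed.

Lemma fire_rcons_inv M s t M'' : fire M (rcons s t) M'' ->
  exists M', fire M s M' /\ fire1 M' t M''.
Proof.
elim: s M => [|u s IHs] M /=; first by move=> [M1 [? ->]]; exists M.
by move=> [M1 [Mu /IHs[M' [M1s M't]]]]; exists M'; split=> //; exists M1.
Qed.

Lemma reach_trans M M' M'' : reach M M' -> reach M' M'' -> reach M M''.
Proof. by move=> [s1 F1] [s2 F2]; exists (s1 ++ s2); apply: fire_cat F1 F2. Qed.

Lemma effect_cons p t s :
  effect p (fun u => count_mem u (t :: s)) =
  incidence p t + effect p (fun u => count_mem u s).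
Proof.
rewrite /effect.
under eq_bigr => u _ do rewrite /= PoszD mulrDr.
rewrite big_split /= (bigD1 t) //= eqxx mulr1 big1 ?addr0 // => u /negbTE ut.
by rewrite eq_sym ut mulr0.
Qed.

Lemma fire_effect M s M' : fire M s M' ->
  forall p, (M' p)%:Z = (M p)%:Z + effect p (fun t => count_mem t s).
Proof.
elim: s M => [|t s IHs] M.
  by move=> -> p; rewrite /effect big1 ?addr0 // => t _; rewrite mulr0.
by move=> [M1 [[_ MM1] /IHs M1M']] p; rewrite M1M' MM1 effect_cons -addrA.
Qed.

Lemma eq_marking M M' : (forall p, (M p)%:Z = (M' p)%:Z) -> M = M'.
Proof. by move=> eqM; apply/ffunP=> p; case: (eqM p). Qed.

Lemma fire_nseq_source t M n : (forall p, Pre N p t = 0%N) ->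
  exists M', fire M (nseq n t) M' /\
    forall p, M' p = (M p + n * Post N p t)%N.
Proof.
move=> src; elim: n M => [|n IHn] M; first by exists M; split=> // p; lia.
have enMt : enabled M t by apply/forallP=> p; rewrite src.
have [M1 MtM1] := enabled_fire1 enMt.
have [M' [M1M' M'E]] := IHn M1; exists M'; split; first by exists M1.
move=> p; have := MtM1.2 p; rewrite /incidence src M'E; lia.
Qed.

End NetTheory.

(** * Acyclic nets: firability from the state equation, and termination *)

Section AcyclicNet.
Variable N : net.
Hypothesis acyclicN : acyclic N.
Implicit Types (M : marking N) (t : trans N) (s : seq (trans N)).

Let arc := @net_arc N.

(** The number of reachable nodes serves as a numeric rank in place of a topological order. *)
Definition height (x : place N + trans N) : nat := #|connect arc x|.

(** Whatever [y] reaches, [x] reaches too, but [y] cannot reach [x] back without closing a cycle. *)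
Lemma height_arc x y : arc x y -> (height y < height x)%N.
Proof.
move=> xy; apply/proper_card/properP; split.
  by apply/fintype.subsetP=> z; apply: connect_trans (connect1 xy).
exists x; first exact: connect0.
apply/negP=> /connectP[c yc xE].
suff /acyclicN : path.cycle arc (y :: c) by [].
by rewrite /= rcons_path yc -xE.
Qed.

(* Among the transitions still to be fired, one of maximal height has no
   producer for its input places left, so it must already be enabled. *)
Lemma acyclic_fire M (y : trans N -> nat) M' :
  (forall p, (M' p)%:Z = (M p)%:Z + effect p y) ->
  exists s, fire M s M'.
Proof.
have [n] := ubnP (\sum_t y t)%N; elim: n M y => // n IHn M y yn M'E.
have [y0|] := boolP [forall t, y t == 0%N].
  exists [::]; apply/eq_marking=> p; rewrite M'E /effect big1 ?addr0 // => t _.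
  by rewrite (eqP (forallP y0 t)) mulr0.
rewrite negb_forall => /existsP[t0 yt0].
case: (@arg_maxnP _ t0 (fun t => y t != 0%N) (fun t => height (inr t)) yt0).
move=> t yt tmax.
have enMt : enabled M t.
  apply/forallP=> p; have [->//|pt] := posnP (Pre N p t).
  (* Since [M' p] is nonnegative, a net loss of at least [Pre N p t] tokens at [p] forces [M p] to
     contain that many. *)
  suff : effect p y <= - (Pre N p t)%:Z by have := M'E p; lia.
  have noprod u : y u != 0%N -> Post N p u = 0%N.
    move=> /tmax hu; apply/eqP; rewrite -leqn0 leqNgt; apply/negP=> up.
    have := @height_arc (inr u) (inl p) up.
    have := @height_arc (inl p) (inr t) pt; move: hu; rewrite /=; lia.
  rewrite /effect (bigD1 t) //= -[leRHS]addr0 lerD //.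
    by rewrite /incidence noprod //; move: yt; nia.
  apply: sumr_le0 => u _; have [->|/noprod] := eqVneq (y u) 0%N.
    by rewrite mulr0.
  by rewrite /incidence => ->; nia.
have [M1 MtM1] := enabled_fire1 enMt.
pose y1 u := (y u - (u == t))%N.
(* The truncated subtraction in [y1] is exact because [y t] is nonzero. *)
have yE u : (y u)%:Z = (y1 u)%:Z + (u == t)%:Z.
  by rewrite /y1; case: eqVneq => [->|_]; lia.
have y1n : (\sum_u y1 u < n)%N.
  suff : (\sum_u y u = \sum_u y1 u + 1)%N by lia.
  rewrite (eq_bigr (fun u => y1 u + (u == t))%N) => [|u _].
    rewrite big_split /= [X in (_ + X)%N](bigD1 t) //= eqxx.
    by rewrite [X in (_ + (_ + X))%N]big1 // => u /negbTE->.
  by have := yE u; lia.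
have [|s M1s] := IHn M1 y1 y1n; last by exists (t :: s), M1.
move=> p; rewrite M'E MtM1.2 -addrA; congr (_ + _).
rewrite /effect (eq_bigr _ (fun u _ => congr1 _ (yE u))).
under eq_bigr => u _ do rewrite mulrDr.
rewrite big_split /= addrC; congr (_ + _).
rewrite (bigD1 t) //= eqxx mulr1 big1 ?addr0 // => u /negbTE->.
by rewrite mulr0.
Qed.

(** Think of [M1] and [M2] as one vector plus the effects of [s1] and [s2]. Leaving that vector out
    lets it include the effect of an explicit transition, and keeps it from having to be a
    marking. *)
Lemma acyclic_fire_diff M1 M2 s1 s2 :
  (forall t, count_mem t s1 <= count_mem t s2)%N ->
  (forall p, (M2 p)%:Z + effect p (fun t => count_mem t s1) =
             (M1 p)%:Z + effect p (fun t => count_mem t s2)) ->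
  exists s, fire M1 s M2.
Proof.
move=> le12 M12.
apply: (@acyclic_fire _ (fun t => count_mem t s2 - count_mem t s1)%N) => p.
suff -> : effect p (fun t => count_mem t s2 - count_mem t s1)%N =
    effect p (fun t => count_mem t s2) - effect p (fun t => count_mem t s1).
  by rewrite addrA -M12 addrK.
rewrite /effect -sumrB; apply: eq_bigr => t _.
by rewrite -mulrBr subzn.
Qed.

(* Weight each place by [B ^ height] with [B] exceeding the total output of
   any transition: consuming one token then outweighs everything produced. *)
Lemma acyclic_terminating :
  (forall t, exists p, (0 < Pre N p t)%N) ->
  exists Phi : marking N -> nat,
    forall M s M', fire M s M' -> (size s + Phi M' <= Phi M)%N.
Proof.
move=> input.
pose B := (\sum_t \sum_p Post N p t).+1.
pose w p := (B ^ height (inl p))%N.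
have wlt t : (\sum_p Post N p t * w p < \sum_p Pre N p t * w p)%N.
  have [p pt] := input t.
  have hp := @height_arc (inl p) (inr t) pt.
  have wp : (w p <= \sum_p Pre N p t * w p)%N.
    by rewrite (bigD1 p) //=; move: pt; nia.
  (* With [b = B ^ (height p - 1)], the input place [p] weighs [B * b]. Every output place of [t]
     lies at least two levels below [p], hence weighs at most [b]. *)
  apply: leq_trans wp; rewrite /w -(ltn_predK hp) expnS.
  set b := (B ^ _)%N.
  have b0 : (0 < b)%N by rewrite expn_gt0.
  apply: (@leq_ltn_trans ((\sum_q Post N q t) * b)%N); last first.
    by rewrite ltn_pmul2r // ltnS (bigD1 t) //= leq_addr.
  rewrite big_distrl /=; apply: leq_sum => q _.
  have [->//|qt] := posnP (Post N q t).
  rewrite leq_mul2l leq_pexp2l ?orbT //.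
  by have := @height_arc (inr t) (inl q) qt; lia.
exists (fun M => \sum_p M p * w p)%N => M s M'.
elim: s M => [|t s IHs] M /=; first by move->.
move=> [M1 [[en M1E] /IHs]].
suff : (\sum_p M1 p * w p + \sum_p Pre N p t * w p =
        \sum_p M p * w p + \sum_p Post N p t * w p)%N.
  by have := wlt t; lia.
rewrite -!big_split; apply: eq_bigr => p _ /=; rewrite -!mulnDl.
by congr (_ * _)%N; have := M1E p; rewrite /incidence; lia.
Qed.

End AcyclicNet.

(** * Explanations and runs of the minimax-BRG *)

Section BasisPartition.
Variables (N : net) (pi : basis_partition N).
Implicit Types (M : marking N) (s : seq (implicit_trans pi)).
Implicit Types (t : explicit_trans pi) (e : event pi).

Lemma trans_cases (u : trans N) :
  (exists t, u = val t) \/ (exists i : implicit_trans pi, u = val i).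
Proof.
have : u \in [set: trans N]%SET by rewrite inE.
by rewrite -(partition_cover pi) inE => /orP[] uT; [left|right]; exists (Sub u uT).
Qed.

(** Transfers implicit firings to the induced sub-net, where the acyclicity results apply. *)
Lemma ifireE M s M' : ifire M s M' = @fire (inet pi) M s M'.
Proof.
rewrite /ifire; elim: s M => [//|i s IHs] M /=.
by apply: eq_exists => M1; rewrite IHs.
Qed.

Lemma size_parikh s : size s = (\sum_i parikh s i)%N.
Proof.
elim: s => [|i s IHs]; first by rewrite big1 // => i _; rewrite ffunE.
under eq_bigr => j _ do rewrite ffunE /=.
rewrite big_split /= (bigD1 i) //= eqxx big1 ?addn0 => [|j /negbTE].
  by rewrite add1n IHs; congr _.+1; apply: eq_bigr => j _; rewrite ffunE.
by rewrite eq_sym => ->.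
Qed.

Lemma vle_trans (x y z : ivector pi) : vle x y -> vle y z -> vle x z.
Proof.
move=> /forallP xy /forallP yz; apply/forallP=> i.
exact: leq_trans (xy i) (yz i).
Qed.

Lemma vle_refl (y : ivector pi) : vle y y.
Proof. exact/forallP. Qed.

Lemma vle_size_lt s s' : vle (parikh s) (parikh s') ->
  parikh s <> parikh s' -> (size s < size s')%N.
Proof.
move=> /forallP le ne; rewrite ltn_neqAle !size_parikh leq_sum ?andbT //.
apply/eqP=> eqs; apply: ne; apply/ffunP=> i; apply/eqP.
(* Equality case of a sum of componentwise inequalities: equal totals force equal components. *)
by move: (leqif_sum (P := xpredT) (fun i _ => leqif_eq (le i))) => -[_];
  rewrite eqs eqxx => /esym/forallP /(_ i).
Qed.

Lemma min_explanation M t s : Sigma M t s ->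
  exists2 s', Sigma_min M t s' & vle (parikh s') (parikh s).
Proof.
have [n] := ubnP (size s); elim: n s => // n IHn s sn Ss.
have [[s' [Ss' le ne]]|nex] := pselect (exists s', [/\ Sigma M t s',
    vle (parikh s') (parikh s) & parikh s' <> parikh s]); last first.
  by exists s; [split|exact: vle_refl].
have [|s'' min le'] := IHn s' _ Ss'; first by have := vle_size_lt le ne; lia.
by exists s''; last exact: vle_trans le.
Qed.

(** Each strict enlargement of the Parikh vector lengthens the sequence, so the length bound [k]
    stops the ascent. *)
Lemma max_explanation M t s (k : nat) :
  (forall s', Sigma M t s' -> (size s' <= k)%N) -> Sigma M t s ->
  exists2 s', Sigma_max M t s' & vle (parikh s) (parikh s').
Proof.
move=> bnd; have [n] := ubnP (k - size s); elim: n s => // n IHn s sn Ss.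
have [[s' [Ss' le ne]]|nex] := pselect (exists s', [/\ Sigma M t s',
    vle (parikh s) (parikh s') & parikh s' <> parikh s]); last first.
  by exists s; [split|exact: vle_refl].
have lts := vle_size_lt le (nesym ne).
have [|s'' max le'] := IHn s' _ Ss'; first by have := bnd _ Ss'; lia.
by exists s''; last exact: vle_trans le'.
Qed.

Lemma effect_parikh (p : place N) s :
  \sum_i @incidence (inet pi) p i * (parikh s i)%:Z =
  @effect (inet pi) p (fun i => count_mem i s).
Proof. by apply: eq_bigr => i _; rewrite ffunE. Qed.

Lemma explanation_step M s M1 t M2 : ifire M s M1 -> fire1 M1 (val t) M2 ->
  Sigma_min M t s \/ Sigma_max M t s -> minimax_step M (t, parikh s) M2.
Proof.
rewrite ifireE => /fire_effect M1E [_ M2E] mm; split.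
  by case: mm => mm; [left|right]; exists s.
by move=> p; rewrite M2E effect_parikh -M1E.
Qed.

(** An event records only a Parikh vector, but the state equation fixes its target: the marking
    obtained by firing any explanation with that vector and then [t]. *)
Lemma minimax_step_reach M e M' : minimax_step M e M' -> reach M M'.
Proof.
case: e => t y [/= Yy M'E].
have [s [[M1 [MM1 en]] yE]] : exists s, Sigma M t s /\ parikh s = y.
  by case: Yy => -[s [Ss _] <-]; exists s.
have [M2 M1M2] := enabled_fire1 en.
suff -> : M' = M2 by eexists; apply: fire_rcons MM1 M1M2.
apply: eq_marking => p; rewrite M'E M1M2.2 -yE effect_parikh.
by move: MM1; rewrite ifireE => /fire_effect ->.
Qed.

Lemma minimax_basis_reach Minit M : minimax_basis pi Minit M -> reach Minit M.
Proof.
elim=> [|M1 e M2 _ IH /minimax_step_reach]; first by exists [::].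
exact: reach_trans.
Qed.

Lemma run_reach Minit M (r : seq (event pi)) M' :
  run (minimax_BRG Minit pi) M r M' -> reach M M'.
Proof.
elim: r M => [|e r IHr] M /=; first by move->; exists [::].
move=> [M1 [[_ /minimax_step_reach MM1] /IHr]]; exact: reach_trans.
Qed.

Lemma implicit_reach_reach M M' : implicit_reach pi M M' -> reach M M'.
Proof. by move=> [s MM']; exists [seq val i | i <- s]. Qed.

Lemma run_rcons Minit M (r : seq (event pi)) M1 e M2 :
  run (minimax_BRG Minit pi) M r M1 ->
  delta (minimax_BRG Minit pi) M1 e M2 ->
  run (minimax_BRG Minit pi) M (rcons r e) M2.
Proof.
elim: r M => [|e' r IHr] M /=; first by move=> -> d; exists M2.
by move=> [M' [d /IHr IH]] /IH; exists M'.
Qed.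

Lemma run_basis Minit M (r : seq (event pi)) M' : minimax_basis pi Minit M ->
  run (minimax_BRG Minit pi) M r M' -> minimax_basis pi Minit M'.
Proof.
elim: r M => [|e r IHr] M bM /=; first by move->.
by move=> [M1 [[_ d] /IHr]]; apply; apply: minimax_basis_step bM d.
Qed.

Lemma implicit_reach_diff M1 M2 s1 s2 : vle (parikh s1) (parikh s2) ->
  (forall p, (M2 p)%:Z + @effect (inet pi) p (fun i => count_mem i s1) =
             (M1 p)%:Z + @effect (inet pi) p (fun i => count_mem i s2)) ->
  implicit_reach pi M1 M2.
Proof.
move=> /forallP le M12.
have le12 i : (count_mem i s1 <= count_mem i s2)%N by have := le i; rewrite !ffunE.
have [s M1s] :=
  @acyclic_fire_diff (inet pi) (@partition_acyclic _ pi) M1 M2 s1 s2 le12 M12.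
by exists s; rewrite ifireE.
Qed.

(* A minimal explanation of each explicit transition is fired first; what
   remains of the implicit firings can be postponed. *)
Lemma reach_run Minit Mb M : minimax_basis pi Minit Mb -> reach Mb M ->
  exists Mb' r, run (minimax_BRG Minit pi) Mb r Mb' /\ implicit_reach pi Mb' M.
Proof.
move=> bMb [s]; elim/last_ind: s M => [|s u IHs] M.
  by move=> ->; exists Mb, [::]; split=> //; exists [::].
move=> /fire_rcons_inv[M1 [/IHs[Mb1 [r [Mbr [v Mb1v]]]] M1M]].
have [[t ut]|[i ui]] := trans_cases u; last first.
  exists Mb1, r; split=> //; exists (rcons v i).
  by rewrite /ifire map_rcons -ui; apply: fire_rcons M1M.
subst u; have Sv : Sigma Mb1 t v by exists M1; split=> //; case: M1M.
have [v' minv' le] := min_explanation Sv.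
have [[M2 [Mb1M2 en]] _] := minv'.
have [Mb2 M2Mb2] := enabled_fire1 en.
have step := explanation_step Mb1M2 M2Mb2 (or_introl minv').
exists Mb2, (rcons r (t, parikh v')); split.
  by apply: (run_rcons Mbr); split=> //; apply: run_basis Mbr.
apply: (implicit_reach_diff le).
move: Mb1v Mb1M2; rewrite !ifireE => /fire_effect M1E /fire_effect M2E p.
by rewrite M1M.2 M2Mb2.2 M1E M2E; ring.
Qed.

End BasisPartition.

(** * From reachable markings to basis markings in bounded deadlock-free plants *)

Lemma implicit_input (G : plant) (pi : basis_partition (pnet G)) :
  bounded G -> no_isolated_implicit pi ->
  forall i : implicit_trans pi, exists p, (0 < Pre (inet pi) p i)%N.
Proof.
move=> [k bnd] noiso [u uI]; apply: contrapT => noin.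
have src p : Pre (pnet G) p u = 0%N.
  by apply/eqP; rewrite -leqn0 leqNgt; apply/negP=> pu; apply: noin; exists p.
have [p] := noiso u uI; rewrite src /= => pu.
(* The non-isolated source [u] has an output place [p], where [k.+1] firings exceed the bound. *)
have [M [M0M ME]] := fire_nseq_source (M0 G) k.+1 src.
have := bnd M (ex_intro _ (nseq k.+1 u) M0M) p; rewrite ME; nia.
Qed.

(* Implicit firings terminate and the net never deadlocks, so every run gets to
   an explicit transition [t]; completing the implicit firings to a maximal
   explanation of [t] then leads to a basis marking. *)
Lemma reach_basis (G : plant) (pi : basis_partition (pnet G)) M :
  bounded G -> deadlock_free G -> no_isolated_implicit pi ->
  reach (M0 G) M -> exists2 Mb, minimax_basis pi (M0 G) Mb & reach M Mb.
Proof.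
move=> bndG dfG noiso M0M.
have acI := @partition_acyclic _ pi.
have [Phi PhiP] := acyclic_terminating acI (implicit_input bndG noiso).
have [M1 [t [MM1 en1]]] : exists M1 (t : explicit_trans pi),
    reach M M1 /\ enabled M1 (val t).
  have [n] := ubnP (Phi M); elim: n M M0M => // n IHn M M0M Mn.
  have [u enu] : exists u, enabled M u.
    apply: contrapT => noen; apply: (dfG M M0M) => u.
    by apply/negP=> enu; apply: noen; exists u.
  have [[t ut]|[i ui]] := trans_cases pi u.
    by exists M, t; rewrite -ut; split=> //; exists [::].
  have [M' MM'] := enabled_fire1 enu.
  have RMM' : reach M M' by exists [:: u], M'.
  have [||M1 [t [M'M1 en]]] := IHn M'.
  - exact: reach_trans RMM'.
  - have : @fire (inet pi) M [:: i] M' by rewrite -ifireE /ifire /= -ui; exists M'.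
    by move=> /PhiP /=; lia.
  by exists M1, t; split=> //; apply: reach_trans RMM' M'M1.
(* BRG steps start only at basis markings, so [M1] is traced back to some [Mb], at which [v]
   explains [t]. *)
have [Mb [r [Mbr [v Mbv]]]] :=
  reach_run (minimax_basis_init pi (M0 G)) (reach_trans M0M MM1).
have bMb := run_basis (minimax_basis_init pi (M0 G)) Mbr.
have Sv : Sigma Mb t v by exists M1.
have [|v' maxv' le] := max_explanation (k := Phi Mb) _ Sv.
  by move=> s' [M' []]; rewrite ifireE => /PhiP/(leq_trans (leq_addr _ _)).
have [[M2 [MbM2 en2]] _] := maxv'.
have [Mb2 M2Mb2] := enabled_fire1 en2.
exists Mb2.
  exact: minimax_basis_step bMb (explanation_step MbM2 M2Mb2 (or_intror maxv')).
apply: reach_trans MM1 _.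
(* As [v'] dominates [v], the surplus firings can be carried out from [M1]. *)
have M1M2 : reach M1 M2.
  apply/implicit_reach_reach/(implicit_reach_diff le).
  move: Mbv MbM2; rewrite !ifireE => /fire_effect M1E /fire_effect M2E p.
  by rewrite M1E M2E; ring.
by apply: reach_trans M1M2 _; exists [:: val t], Mb2.
Qed.

Theorem theorem1 (G : plant) (pi : basis_partition (pnet G))
  (hbounded : bounded G) (hdeadlock : deadlock_free G)
  (hisolated : no_isolated_implicit pi) :
  nonblocking G <-> unobstructed pi.
Proof.
split=> [nb Mb bMb | uo M M0M].
  have [Mf [MbMf finMf]] := nb Mb (minimax_basis_reach bMb).
  have [Mb' [s [MbMb' Mb'Mf]]] := reach_run bMb MbMf.
  exists Mb', s; split=> //; split; first exact: run_basis MbMb'.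
  by exists Mf.
(* Unobstructedness speaks only of basis markings, so [M] is first led to one. *)
have [Mb bMb MMb] := reach_basis hbounded hdeadlock hisolated M0M.
have [Mb' [s [[_ [Mf [Mb'Mf finMf]]] /run_reach MbMb']]] := uo Mb bMb.
exists Mf; split=> //.
exact: reach_trans MMb (reach_trans MbMb' (implicit_reach_reach Mb'Mf)).
Qed.
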